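(* $\mathrm{irred}(n)/p(n)\to 1$ as $n\to\infty$.
   Context: A sum of cycles is a finite digraph that is a disjoint union of directed cycles, considered up to isomorphism. $C_\ell$ is the directed cycle of length $\ell$. The sum $A+B$ is disjoint union, and the product $AB$ is the direct product of digraphs, i.e. the distributive product with $C_aC_b=\gcd(a,b)\,C_{\operatorname{lcm}(a,b)}$ (where $nC_\ell$ denotes $n$ disjoint copies of $C_\ell$). A sum of cycles $X$ is irreducible if, for all sums of cycles $A,B$, $X=AB$ implies $A=C_1$ or $B=C_1$. $\mathrm{irred}(n)$ is the number of irreducible sums of cycles with $n$ vertices, and $p(n)$ is the number of integer partitions of $n$, which is also the number of sums of cycles with $n$ vertices. *)

(* Defs.v *)
From HB Require Import structures.
From mathcomp Require Import all_boot all_order all_algebra.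
From mathcomp Require Import all_classical all_reals all_analysis.

Set Implicit Arguments.
Unset Strict Implicit.
Unset Printing Implicit Defensive.

Record digraph := Digraph { vert :> finType; edge : rel vert }.

Definition diso (G H : digraph) : Prop :=
  exists2 f : G -> H,
    bijective f & forall x y, edge (f x) (f y) = edge x y.

Definition dempty : digraph := @Digraph void (fun _ _ => false).

Definition dsum (G H : digraph) : digraph :=
  @Digraph (G + H)%type (fun u v =>
    match u, v with
    | inl x, inl y => edge x y
    | inr x, inr y => edge x y
    | _, _ => false
    end).

Definition dprod (G H : digraph) : digraph :=
  @Digraph (G * H)%type (fun u v => edge u.1 v.1 && edge u.2 v.2).

(* The directed cycle of length l > 0; in particular dcycle 1 is a loop. *)
Definition dcycle (l : nat) : digraph :=
  @Digraph 'I_l (fun i j => j == i.+1 %% l :> nat).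

Definition sum_of_cycles (G : digraph) : Prop :=
  exists2 s : seq nat,
    all (fun l => 0 < l) s & diso G (foldr dsum dempty (map dcycle s)).

(* Sums of cycles are considered up to isomorphism, so equality is diso. *)
Definition irreducible_sum (X : digraph) : Prop :=
  sum_of_cycles X /\
  forall A B : digraph, sum_of_cycles A -> sum_of_cycles B ->
    diso X (dprod A B) -> diso A (dcycle 1) \/ diso B (dcycle 1).

Definition digraph_on (n : nat) (E : {set 'I_n * 'I_n}) : digraph :=
  @Digraph 'I_n (fun i j => (i, j) \in E).

(* Number of isomorphism classes of irreducible sums of cycles on n vertices;
   every digraph on n vertices is isomorphic to one with vertex set 'I_n. *)
Definition irred (n : nat) : nat :=
  #|equivalence_partition
      (fun E F : {set 'I_n * 'I_n} => `[< diso (digraph_on E) (digraph_on F) >])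
      [set E | `[< irreducible_sum (digraph_on E) >]]%SET|.

Definition is_int_part (n : nat) (s : seq nat) : bool :=
  [&& sorted geq s, all (fun k => 0 < k) s & sumn s == n].

(* A partition of n has at most n parts, each at most n, so ranging over
   n.-bseq 'I_n.+1 loses nothing. *)
Definition partition_number (n : nat) : nat :=
  #|[set s : n.-bseq 'I_n.+1 | is_int_part n (map val s)]%SET|.

(* Main.v *)
Require Import Defs.
From HB Require Import structures.
From mathcomp Require Import all_boot all_order all_algebra.
From mathcomp Require Import all_classical all_reals all_analysis.
From mathcomp Require Import zify.
Import Order.TTheory GRing.Theory Num.Theory.
Import numFieldNormedType.Exports.
Import fintype boot.finset.

(** Sums of cycles on n vertices correspond to partitions of n: the multiset of
    cycle lengths is a complete isomorphism invariant ([perm_cycles] and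
    [cycles_perm]). Hence irred n counts the partitions of n whose sum of cycles
    is irreducible ([irredE]).

    A reducible sum of cycles on n > 0 vertices is a product of two sums of
    cycles on d and e vertices, with d e = n and d, e > 1, and is determined by
    its two factors. So at most the sum of p(d) p(e) over these factorisations
    of n is lost ([reducible_parts], [card_prod_parts]).

    It remains to see that this sum is negligible with respect to p(n), for
    which explicit injections suffice; no asymptotics of p is used.
    - If 2 e + 3 d <= m then p(d) p(e) <= p(m) ([partition_number_mul]). With
      m = n / 2 this covers all factorisations but those where one factor is at
      most 9, and these satisfy p(d) p(e) <= p(9) p(n / 2). So every
      factorisation contributes O(p(n / 2)) ([partition_number_factor]).
    - p(n / 2) 2^k <= 2 p(n) as soon as k is small compared to the square root
      of n ([partition_number_growth]): k bits are hidden in the parities of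
      multiplicities, after doubling the multiplicities of some of the parts.
      With k about 2 log2 n, this gives p(n / 2) = O(p(n) / n^2)
      ([partition_number_half]).

    As there are at most n factorisations, the proportion of reducible sums is
    O(1 / n). *)

Set Implicit Arguments.
Unset Strict Implicit.
Unset Printing Implicit Defensive.
Local Open Scope nat_scope.

(** * Counting *)

(** Injections between classes of partitions and digraphs are only defined up
    to reordering or isomorphism, so they are given as relations. *)
Lemma leq_card_rel (T U : finType) (A : {set T}) (B : {set U})
    (r : T -> U -> Prop) :
    (forall x, x \in A -> exists2 y, y \in B & r x y) ->
    (forall x x' y, x \in A -> x' \in A -> r x y -> r x' y -> x = x') ->
  #|A| <= #|B|.
Proof.
move=> rAB rinj.
have [->|[x0 x0A]] := set_0Vmem A; first by rewrite cards0.
have [y0 _ _] := rAB x0 x0A.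
have /boolp.choice[f fP] : forall x, exists y, x \in A -> y \in B /\ r x y.
  move=> x; have [/rAB[y yB rxy]|_] := boolP (x \in A); last by exists y0.
  by exists y.
have finj : {in A &, injective f}.
  move=> x x' xA x'A e; apply: (rinj _ _ (f x)) => //; first by case: (fP x xA).
  by rewrite e; case: (fP x' x'A).
rewrite -(card_in_imset finj); apply/subset_leq_card/subsetP => _ /imsetP[x xA ->].
by case: (fP x xA).
Qed.

Lemma card_bigcup_le (I T : finType) (P : pred I) (F : I -> {set T}) c :
  (forall i, P i -> #|F i| <= c) -> #|\bigcup_(i | P i) F i| <= #|P| * c.
Proof.
move=> Fc; rewrite -sum_nat_const.
apply: (big_ind2 (fun (A : {set T}) m => #|A| <= m)) => //.
  by rewrite cards0.
move=> A m B k Am Bk; apply: leq_trans (leq_card_setU _ _) _.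
exact: leq_add.
Qed.

(** * Encoding partitions as lists *)

(** Partitions as unordered lists: the order of the parts is left free so that
    lists built by concatenation need no sorting. *)
Definition is_parts n (s : seq nat) := all (fun k => 0 < k) s && (sumn s == n).

Definition int_parts n : {set n.-bseq 'I_n.+1} :=
  [set s : n.-bseq 'I_n.+1 | is_int_part n (map val s)]%SET.

Definition parts n (s : n.-bseq 'I_n.+1) : seq nat := map val s.

Lemma parts_is_parts n (s : n.-bseq 'I_n.+1) :
  s \in int_parts n -> is_parts n (parts s).
Proof. by rewrite inE => /and3P[_ ? ?]; apply/andP. Qed.

Lemma parts_perm_inj n (s t : n.-bseq 'I_n.+1) :
  s \in int_parts n -> t \in int_parts n ->
  perm_eq (parts s) (parts t) -> s = t.
Proof.
rewrite !inE => /and3P[ss _ _] /and3P[st _ _] pst.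
apply/val_inj/(inj_map val_inj)/(sorted_eq _ _ ss st pst).
  by move=> y x z xy yz; apply: leq_trans yz xy.
by move=> x y; rewrite andbC => /anti_leq.
Qed.

Lemma is_parts_size n s : is_parts n s -> size s <= n.
Proof.
case/andP=> + /eqP <-; elim: s => //= x s IHs /andP[x0 /IHs]; lia.
Qed.

Lemma is_parts_le n s x : is_parts n s -> x \in s -> x <= n.
Proof.
case/andP=> _ /eqP <-; elim: s => //= y s IHs.
rewrite inE => /orP[/eqP->|/IHs]; lia.
Qed.

Lemma perm_is_parts n s t : perm_eq s t -> is_parts n s = is_parts n t.
Proof. by move=> st; rewrite /is_parts (perm_all _ st) (perm_sumn st). Qed.

Lemma int_parts_ex n s : is_parts n s ->
  exists2 t, t \in int_parts n & perm_eq (parts t) s.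
Proof.
move=> ps; pose u := sort geq s.
have pu : perm_eq u s by rewrite perm_sort.
have ppu : is_parts n u by rewrite (perm_is_parts _ pu).
pose v : seq 'I_n.+1 := map inord u.
have vu : map val v = u.
  rewrite -map_comp -[RHS]map_id; apply/eq_in_map => x /= xu.
  by rewrite inordK // ltnS (is_parts_le ppu).
have sv : size v <= n by rewrite size_map is_parts_size.
exists (Bseq sv); last by rewrite /parts /= vu.
rewrite inE /is_int_part /= vu; case/andP: ppu => -> ->; rewrite !andbT.
by apply: sort_sorted => x y; apply: leq_total.
Qed.

(** The tool for every lower bound on a partition number below: it suffices to
    encode the elements of A by lists of positive integers of sum n, injectively
    up to reordering. *)
Lemma card_le_partition_number n (T : finType) (A : {set T}) (f : T -> seq nat) :
    (forall x, x \in A -> is_parts n (f x)) ->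
    (forall x y, x \in A -> y \in A -> perm_eq (f x) (f y) -> x = y) ->
  #|A| <= partition_number n.
Proof.
move=> fA finj.
apply: (@leq_card_rel _ _ _ (int_parts n) (fun x t => perm_eq (f x) (parts t))).
  move=> x xA; have [t tP tx] := int_parts_ex (fA x xA).
  by exists t => //; rewrite perm_sym.
move=> x x' y xA x'A xy x'y; apply: finj => //.
by rewrite perm_sym in x'y; apply: perm_trans xy x'y.
Qed.

Lemma all_pos_nseq1 r : all (fun k => 0 < k) (nseq r 1).
Proof. by rewrite all_nseq orbT. Qed.

Lemma partition_number_mono m n :
  m <= n -> partition_number m <= partition_number n.
Proof.
move=> mn; apply: (@card_le_partition_number n _ (int_parts m)
  (fun s => parts s ++ nseq (n - m) 1)) => [s|s t sP tP].
  case/parts_is_parts/andP=> s0 /eqP sm.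
  by rewrite /is_parts all_cat s0 all_pos_nseq1 sumn_cat sm sumn_nseq mul1n subnKC /=.
by rewrite perm_cat2r; apply: parts_perm_inj.
Qed.

Lemma partition_number_gt0 n : 0 < partition_number n.
Proof.
rewrite -[1](cards1 tt).
by apply: (@card_le_partition_number n _ _ (fun _ => nseq n 1)) => [x _|[] []//];
  rewrite /is_parts all_pos_nseq1 sumn_nseq mul1n /=.
Qed.

Lemma perm_pos (s t : seq nat) :
    all (fun k => 0 < k) s -> all (fun k => 0 < k) t ->
    (forall x, 0 < x -> count_mem x s = count_mem x t) -> perm_eq s t.
Proof.
move=> s0 t0 st; apply/allP => x xst; apply/eqP/st.
by move: xst; rewrite mem_cat => /orP[/(allP s0)|/(allP t0)].
Qed.

Lemma count_sumn_gt1 (s : seq nat) : all (fun k => 0 < k) s ->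
  sumn s = count_mem 1 s + sumn (seq.filter (fun x => 1 < x) s).
Proof.
elim: s => //= x s IHs /andP[x0 /IHs->].
by case: eqP => [->|?] /=; [lia|rewrite (_ : 1 < x) /=; lia].
Qed.

(** The parts equal to 1 are recovered from the sum; encodings may therefore
    use them freely as padding. *)
Lemma is_parts_perm n s t : is_parts n s -> is_parts n t ->
  (forall x, 1 < x -> count_mem x s = count_mem x t) -> perm_eq s t.
Proof.
move=> /andP[s0 /eqP sn] /andP[t0 /eqP tn] st; apply: perm_pos => // x.
rewrite leq_eqVlt => /orP[/eqP<-|]; last exact: st.
have /perm_sumn E : perm_eq (seq.filter (fun x => 1 < x) s)
                            (seq.filter (fun x => 1 < x) t).
  apply: perm_pos; rewrite ?all_filter.
  - by apply: sub_all s0 => y /= ->; rewrite implybT.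
  - by apply: sub_all t0 => y /= ->; rewrite implybT.
  move=> y y0; rewrite !count_filter; have [y1|y1] := ltnP 1 y.
    by rewrite !(eq_count (a1 := predI _ _) (a2 := pred1 y)) ?st// => z /=; lia.
  by rewrite !(eq_count (a1 := predI _ _) (a2 := pred0)) ?count_pred0// => z /=; lia.
have := count_sumn_gt1 s0; have := count_sumn_gt1 t0; lia.
Qed.

(** * Products of partition numbers *)

Lemma sumn_map_double s : sumn (map double s) = (sumn s).*2.
Proof. elim: s => //= x s ->; lia. Qed.

Lemma sumn_map_doubleS s : sumn (map (fun i => i.*2.+1) s) = (sumn s).*2 + size s.
Proof. elim: s => //= x s ->; lia. Qed.

Lemma all_pos_double s :
  all (fun k => 0 < k) s -> all (fun k => 0 < k) (map double s).
Proof. by rewrite all_map; apply: sub_all => x /=; lia. Qed.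

Lemma all_pos_doubleS s : all (fun k => 0 < k) (map (fun i => i.*2.+1) s).
Proof. by rewrite all_map; apply/allP. Qed.

(** Send (lambda, mu) to the partition with parts 2 mu_i and 2 lambda_j + 1,
    padded with parts equal to 1. The parts of the two kinds are told apart by
    parity, and 2 lambda_j + 1 > 1 keeps them apart from the padding. The weight
    before padding is 2 e + 2 d + (number of parts of lambda) <= 2 e + 3 d. *)
Lemma partition_number_mul d e m : 2 * e + 3 * d <= m ->
  partition_number d * partition_number e <= partition_number m.
Proof.
move=> dem; rewrite -(cardsX (int_parts d) (int_parts e)).
pose g (u : d.-bseq 'I_d.+1 * e.-bseq 'I_e.+1) :=
  map double (parts u.2) ++ map (fun i => i.*2.+1) (parts u.1).
apply: (@card_le_partition_number m _ (setX (int_parts d) (int_parts e))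
  (fun u => g u ++ nseq (m - sumn (g u)) 1)).
  case=> s t /setXP[/parts_is_parts sP /parts_is_parts tP].
  have ss := is_parts_size sP.
  case/andP: sP => s0 /eqP sd; case/andP: tP => t0 /eqP te.
  rewrite /is_parts !all_cat all_pos_nseq1 all_pos_double//= all_pos_doubleS.
  rewrite sumn_cat sumn_nseq mul1n subnKC ?eqxx//.
  rewrite /g /= sumn_cat sumn_map_double sumn_map_doubleS; lia.
case=> s t [s' t'] /setXP[sP tP] /setXP[s'P t'P] /permP st.
have even_cnt x (a b : seq nat) r : 0 < x ->
    count_mem x.*2 ((map double a ++ map (fun i => i.*2.+1) b) ++ nseq r 1)
    = count_mem x a.
  move=> x0; rewrite !count_cat !count_map count_nseq /=.
  rewrite [X in X + _ + _](@eq_count _ _ (pred1 x)); last by move=> y /=; lia.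
  rewrite [X in _ + X + _](@eq_count _ _ pred0); last by move=> y /=; lia.
  rewrite count_pred0 (_ : nat_of_bool _ = 0) ?mul0n ?addn0//.
  by move: x0; case: (x).
have odd_cnt x (a b : seq nat) r : 0 < x ->
    count_mem x.*2.+1 ((map double a ++ map (fun i => i.*2.+1) b) ++ nseq r 1)
    = count_mem x b.
  move=> x0; rewrite !count_cat !count_map count_nseq /=.
  rewrite [X in X + _ + _](@eq_count _ _ pred0); last by move=> y /=; lia.
  rewrite [X in _ + X + _](@eq_count _ _ (pred1 x)); last by move=> y /=; lia.
  rewrite count_pred0 (_ : nat_of_bool _ = 0) ?mul0n ?addn0//.
  by move: x0; case: (x).
congr pair; apply: parts_perm_inj => //; apply: perm_pos.
- by case/andP: (parts_is_parts sP).
- by case/andP: (parts_is_parts s'P).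
- by move=> x x0; have := st (pred1 x.*2.+1); rewrite !odd_cnt.
- by case/andP: (parts_is_parts tP).
- by case/andP: (parts_is_parts t'P).
- by move=> x x0; have := st (pred1 x.*2); rewrite !even_cnt.
Qed.

(** * Growth of the partition numbers *)

Lemma sumn_filter_le (a : pred nat) s : sumn (seq.filter a s) <= sumn s.
Proof. by elim: s => //= x s IHs; case: (a x) => /=; lia. Qed.

(** The two values of c give disjoint classes of integers, neither containing
    1, so that in every partition one of the two carries at most half of the
    sum. *)
Definition parity_class (c : bool) : pred nat := fun x => (1 < x) && (odd x == c).

(** Enumerates [parity_class c] in increasing order: the bits sit at the smallest
    available parts, so that k of them cost only O(k^2). *)
Definition slot (c : bool) (j : nat) := j.*2 + 2 + c.

Lemma slot_class c j : parity_class c (slot c j).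
Proof. by rewrite /parity_class /slot; case: c; lia. Qed.

Lemma slot_inj c : injective (slot c).
Proof. by move=> i j; rewrite /slot; lia. Qed.

Lemma sumn_slots k c (S : {set 'I_k}) :
  sumn [seq slot c (val j) | j <- enum S] <= k * (2 * k + 1).
Proof.
suff H (s : seq 'I_k) :
    sumn [seq slot c (val j) | j <- s] <= size s * (2 * k + 1).
  apply: leq_trans (H _) _; rewrite leq_mul2r -cardE.
  by rewrite (leq_trans (max_card _)) ?card_ord ?orbT.
elim: s => //= j s IHs; rewrite mulSn leq_add//.
by have := ltn_ord j; rewrite /slot; case: (c) => /=; lia.
Qed.

Lemma sumn_parity_classes s :
  sumn (seq.filter (parity_class false) s) + sumn (seq.filter (parity_class true) s)
  <= sumn s.
Proof.
rewrite /parity_class; elim: s => //= x s IHs; case: (1 < x) => /=; last by lia.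
by case: (odd x) => /=; lia.
Qed.

(** The partitions in which doubling the multiplicity of all parts of the class
    c increases the sum by at most half. *)
Definition light_parts n (c : bool) : {set n.-bseq 'I_n.+1} :=
  [set s in int_parts n | 2 * sumn (seq.filter (parity_class c) (parts s)) <= n]%SET.

(** A light partition of m together with k bits is encoded in a partition of n:
    the multiplicity of each part of the class c is doubled, the j-th bit is
    added to the multiplicity of [slot c j], where it is read off as a parity,
    and parts equal to 1 are used as padding. The doubling costs at most m / 2
    and the bits at most k (2 k + 1) <= m / 2, so that the sum before padding
    is at most 2 m <= n. *)
Lemma card_light_parts m n k c : 2 * m <= n -> 2 * k * (2 * k + 1) <= m ->
  #|light_parts m c| * 2 ^ k <= partition_number n.
Proof.
move=> mn km.
have -> : 2 ^ k = #|powerset [set: 'I_k]%SET| by rewrite card_powerset cardsT card_ord.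
rewrite -cardsX.
(* Parts equal to 1 are dropped: the padding takes their place. *)
pose g (u : m.-bseq 'I_m.+1 * {set 'I_k}) :=
  seq.filter (predC1 1) (parts u.1) ++ seq.filter (parity_class c) (parts u.1)
  ++ [seq slot c (val j) | j <- enum u.2].
apply: (@card_le_partition_number n _
  (setX (light_parts m c) (powerset [set: 'I_k]%SET))
  (fun u => g u ++ nseq (n - sumn (g u)) 1)).
  case=> s S /setXP[]; rewrite inE => /andP[/parts_is_parts sP sl] _.
  case/andP: sP => s0 /eqP sm.
  rewrite /is_parts /g !all_cat all_pos_nseq1 !all_filter all_map andbT /=.
  rewrite sumn_cat sumn_nseq mul1n subnKC ?eqxx ?andbT.
    apply/and3P; split; try by apply: sub_all s0 => x /= ?; apply/implyP.
    by apply/allP => j _ /=; rewrite /slot; lia.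
  rewrite !sumn_cat.
  have := sumn_filter_le (predC1 1) (parts s); have := sumn_slots c S.
  rewrite /= sm; lia.
case=> s S [t T] /setXP[sP _] /setXP[tP _] /permP st.
have {}sP : s \in int_parts m by move: sP; rewrite inE => /andP[].
have {}tP : t \in int_parts m by move: tP; rewrite inE => /andP[].
have cnt x (u : m.-bseq 'I_m.+1 * {set 'I_k}) r : 1 < x ->
    count_mem x (g u ++ nseq r 1) = count_mem x (parts u.1)
     + (if parity_class c x then count_mem x (parts u.1) else 0)
     + (x \in [seq slot c (val j) | j <- enum u.2]).
  move=> x1; rewrite !count_cat !count_filter count_nseq.
  rewrite (_ : pred1 x 1 = false) ?mul0n ?addn0; last by rewrite /=; lia.
  rewrite [X in _ + (_ + X)]count_uniq_mem; last first.
    by rewrite map_inj_uniq ?enum_uniq// => i j /slot_inj/val_inj.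
  rewrite addnA; congr (_ + _ + _); first by apply: eq_count => y /=; lia.
  case: ifP => xc; first by apply: eq_count => y /=; case: eqP => //= ->.
  by rewrite (eq_count (a2 := pred0)) ?count_pred0// => y /=; case: eqP => //= ->.
have bit x : ~~ parity_class c x ->
    forall V : {set 'I_k}, (x \in [seq slot c (val j) | j <- enum V]) = false.
  move=> xc V; apply: contraNF xc => /mapP[j _ ->]; exact: slot_class.
have cnt_eq x : 1 < x -> count_mem x (parts s) = count_mem x (parts t)
    /\ (x \in [seq slot c (val j) | j <- enum S])
       = (x \in [seq slot c (val j) | j <- enum T]).
  move=> x1; have := st (pred1 x); rewrite !cnt //=.
  case: ifP => xc; last by rewrite !bit ?xc// !addn0.
  by do 2![case: (_ \in _)]; lia.
congr pair.
  apply: parts_perm_inj => //.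
  by apply: (@is_parts_perm m); [exact: parts_is_parts..|move=> x /cnt_eq[]].
apply/setP => j; have [_] := @cnt_eq (slot c j) (proj1 (andP (slot_class c j))).
have fI : injective (fun i : 'I_k => slot c (val i)).
  by move=> i i' /slot_inj/val_inj.
by rewrite 2!(mem_map fI) 2!mem_enum.
Qed.

(** Doubling all multiplicities would double the sum and leave no room for the
    bits; doubling only the lighter of the two parity classes leaves room, at
    the cost of the factor 2. *)
Lemma partition_number_growth m n k : 2 * m <= n -> 2 * k * (2 * k + 1) <= m ->
  partition_number m * 2 ^ k <= 2 * partition_number n.
Proof.
move=> mn km.
have H : partition_number m <= #|light_parts m false| + #|light_parts m true|.
  apply: leq_trans (leq_card_setU _ _); apply/subset_leq_card/subsetP => s sP.
  have lE c : (s \in light_parts m c) =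
      (2 * sumn (seq.filter (parity_class c) (parts s)) <= m) by rewrite inE sP.
  rewrite in_setU !lE.
  have := sumn_parity_classes (parts s).
  by case/andP: (parts_is_parts sP) => _ /eqP->; lia.
apply: leq_trans (leq_mul H (leqnn _)) _.
by rewrite mulnDl mul2n -addnn leq_add ?card_light_parts.
Qed.

Lemma quadratic_le_exp2 l : 14 <= l -> 32 * (l * l) + 8 * l <= 2 ^ l.
Proof.
elim: l => // l IHl; rewrite leq_eqVlt => /orP[/eqP<-//|]; rewrite ltnS => l14.
by have := IHl l14; rewrite expnS; nia.
Qed.

(** The growth lemma is used with k = 2 log2 n: the gain 2 ^ k exceeds n ^ 2 / 4
    while k is still far below the square root of n. *)
Lemma partition_number_half n : 2 ^ 14 <= n ->
  n ^ 2 * partition_number (n %/ 2) <= 8 * partition_number n.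
Proof.
move=> n14; set l := trunc_log 2 n.
have n0 : 0 < n by apply: leq_trans n14.
have /andP[ln nl] := trunc_log_bounds (isT : 1 < 2) n0.
have l14 : 14 <= l by apply: trunc_log_max.
have lM : 2 * (2 * l) * (2 * (2 * l) + 1) <= n %/ 2.
  by rewrite leq_divRL//; apply: leq_trans ln; apply: leq_trans (quadratic_le_exp2 l14); lia.
have := partition_number_growth (_ : 2 * (n %/ 2) <= n) lM.
rewrite mulnC leq_divM => /(_ isT) growth.
have n2 : n ^ 2 <= 4 * 2 ^ (2 * l).
  rewrite (_ : 4 * _ = (2 ^ l.+1) ^ 2); first by rewrite leq_sqr ltnW.
  by rewrite (mulnC 2 l) expnM (expnS 2 l) expnMn.
by nia.
Qed.

(** Let d <= e. If d >= 10, then 2 e + 3 d <= 5 e <= n / 2 and the product lemma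
    applies; the finitely many remaining d are absorbed in a constant, as
    e <= n / 2. *)
Lemma partition_number_factor n d e : d * e = n -> 1 < d -> 1 < e ->
  partition_number d * partition_number e
  <= partition_number 9 * partition_number (n %/ 2).
Proof.
wlog de : d e / d <= e => [H|] den d1 e1.
  have [de|/ltnW ed] := leqP d e; first exact: H.
  by rewrite mulnC; apply: H; rewrite // mulnC.
have en : e <= n %/ 2 by rewrite leq_divRL// -den; nia.
have [d9|d9] := leqP d 9; first by rewrite leq_mul// partition_number_mono.
apply: (@leq_trans (partition_number (n %/ 2))).
  by apply: partition_number_mul; rewrite leq_divRL// -den; nia.
by rewrite leq_pmull// partition_number_gt0.
Qed.

(** * Isomorphisms of digraphs *)

Lemma diso_refl G : diso G G.
Proof. by exists id => //; exists id. Qed.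

Lemma diso_sym G H : diso G H -> diso H G.
Proof.
case=> f [g fg gf] fe; exists g; first by exists f.
by move=> x y; rewrite -fe !gf.
Qed.

Lemma diso_trans G H K : diso G H -> diso H K -> diso G K.
Proof.
case=> f fb fe [g gb ge]; exists (g \o f); first exact: bij_comp.
by move=> x y /=; rewrite ge fe.
Qed.

Lemma diso_card G H : diso G H -> #|G| = #|H|.
Proof. by case=> f fb _; apply: bij_eq_card fb. Qed.

Lemma diso_sum G G' H H' : diso G G' -> diso H H' ->
  diso (dsum G H) (dsum G' H').
Proof.
case=> f [f' ff' f'f] fe [g [g' gg' g'g] ge].
exists (fun u => match u with inl x => inl (f x) | inr y => inr (g y) end).
  exists (fun u => match u with inl x => inl (f' x) | inr y => inr (g' y) end).
    by case=> x; rewrite ?ff' ?gg'.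
  by case=> x; rewrite ?f'f ?g'g.
by case=> x [] y /=.
Qed.

Lemma diso_prod G G' H H' : diso G G' -> diso H H' ->
  diso (dprod G H) (dprod G' H').
Proof.
case=> f [f' ff' f'f] fe [g [g' gg' g'g] ge].
exists (fun u => (f u.1, g u.2)).
  by exists (fun u => (f' u.1, g' u.2)) => -[x y] /=; rewrite ?ff' ?gg' ?f'f ?g'g.
by move=> u v /=; rewrite fe ge.
Qed.

Lemma diso_sumCA G H K : diso (dsum G (dsum H K)) (dsum H (dsum G K)).
Proof.
exists (fun u => match u with
  | inl x => inr (inl x) | inr (inl y) => inl y | inr (inr z) => inr (inr z) end).
  exists (fun u => match u with
  | inl x => inr (inl x) | inr (inl y) => inl y | inr (inr z) => inr (inr z) end).
    by move=> [x|[y|z]].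
  by move=> [x|[y|z]].
by move=> [x|[y|z]] [x'|[y'|z']].
Qed.

Lemma diso_sum0 G : diso (dsum G dempty) G.
Proof.
exists (fun u : dsum G dempty =>
  match u with inl x => x | inr y => match y with end end).
  by exists inl => // -[].
by move=> [x|[]] [y|[]].
Qed.

(** * Sums of cycles and partitions *)

Definition cycles (s : seq nat) : digraph := foldr dsum dempty (map dcycle s).

Lemma card_cycles s : #|cycles s| = sumn s.
Proof.
elim: s => [|l s IHs]; first by rewrite /cycles /= card_void.
by rewrite /= -IHs card_sum card_ord.
Qed.

Lemma cycles_rem x s : x \in s -> diso (cycles s) (cycles (x :: rem x s)).
Proof.
elim: s => //= y s IHs; rewrite inE => /orP[/eqP->|xs].
  by rewrite eqxx; apply: diso_refl.
case: eqP => [->|_]; first exact: diso_refl.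
apply: diso_trans (diso_sum (diso_refl _) (IHs xs)) _.
exact: diso_sumCA.
Qed.

Lemma perm_cycles s t : perm_eq s t -> diso (cycles s) (cycles t).
Proof.
elim: s t => [|x s IHs] t.
  by rewrite perm_sym => /perm_nilP->; apply: diso_refl.
move=> st; have xt : x \in t by rewrite -(perm_mem st) mem_head.
apply: diso_sym; apply: diso_trans (cycles_rem xt) _.
apply: diso_sum; first exact: diso_refl.
apply/diso_sym/IHs; rewrite -(perm_cons x); apply: perm_trans st _.
exact: perm_to_rem.
Qed.

Fixpoint walk (G : digraph) k (x y : G) : bool :=
  if k is k'.+1 then [exists z, edge x z && walk k' z y] else x == y.

(** In a sum of cycles these are the vertices of the cycles of length l; put in
    terms of closed walks, the notion makes sense in every digraph and is
    visibly invariant under isomorphism. *)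
Definition on_cycle (G : digraph) l : {set G} :=
  [set x | walk l x x & [forall k : 'I_l, (0 < k) ==> ~~ walk k x x]]%SET.

Lemma walk_iso (G H : digraph) (f : G -> H) : bijective f ->
    (forall x y, edge (f x) (f y) = edge x y) ->
  forall k x y, walk k (f x) (f y) = walk k x y.
Proof.
move=> fb fe; elim=> [|k IHk] x y /=; first exact/inj_eq/bij_inj.
have [g _ gK] := fb.
apply/existsP/existsP => -[z /andP[xz zy]].
  by exists (g z); rewrite -fe -IHk gK xz.
by exists (f z); rewrite fe IHk xz.
Qed.

Lemma diso_on_cycle G H l : diso G H -> #|on_cycle G l| = #|on_cycle H l|.
Proof.
case=> f fb fe; rewrite -(card_imset _ (bij_inj fb)).
have [g _ gK] := fb.
apply: eq_card => y; rewrite -(gK y) mem_imset; last exact: bij_inj.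
rewrite !inE (walk_iso fb fe); congr (_ && _).
by apply: eq_forallb => k; rewrite (walk_iso fb fe).
Qed.

Lemma walk_inl (G H : digraph) k x y :
  @walk (dsum G H) k (inl x) (inl y) = walk k x y.
Proof.
elim: k x => [|k IHk] x //=; apply/existsP/existsP => -[].
  by case=> z // /andP[xz zy]; exists z; rewrite xz -IHk.
by move=> z /andP[xz zy]; exists (inl z); rewrite xz IHk.
Qed.

Lemma walk_inr (G H : digraph) k x y :
  @walk (dsum G H) k (inr x) (inr y) = walk k x y.
Proof.
elim: k x => [|k IHk] x //=; apply/existsP/existsP => -[].
  by case=> z // /andP[xz zy]; exists z; rewrite xz -IHk.
by move=> z /andP[xz zy]; exists (inr z); rewrite xz IHk.
Qed.

Lemma on_cycle_sum G H l :
  #|on_cycle (dsum G H) l| = #|on_cycle G l| + #|on_cycle H l|.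
Proof.
rewrite -!sum1_card big_sumType /=; congr (_ + _); apply: eq_bigl => x;
  rewrite !inE ?walk_inl ?walk_inr; congr (_ && _);
  by apply: eq_forallb => k; rewrite ?walk_inl ?walk_inr.
Qed.

Lemma walk_cycle m k (i j : dcycle m) : walk k i j = (j == (i + k) %% m :> nat).
Proof.
elim: k i => [|k IHk] i /=.
  by rewrite addn0 modn_small ?(valP i)// eq_sym.
have m0 : 0 < m by apply: leq_ltn_trans (valP i).
apply/existsP/idP => [[z /andP[/eqP iz]]|/eqP jE].
  by rewrite IHk iz modnDml addSnnS.
exists (Ordinal (ltn_pmod i.+1 m0)); rewrite eqxx IHk /= modnDml addSnnS.
by rewrite jE.
Qed.

Lemma walk_cycle_loop m k (i : dcycle m) : walk k i i = (m %| k).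
Proof.
rewrite walk_cycle; have im := valP i; rewrite -{1}(modn_small im).
by rewrite -{1}[val i]addn0 eqn_modDl mod0n eq_sym.
Qed.

Lemma on_cycle_cycle m l : 0 < l ->
  #|on_cycle (dcycle m) l| = if m == l then m else 0.
Proof.
move=> l0.
have E (i : dcycle m) : (i \in on_cycle (dcycle m) l) = (m == l).
  have m0 : 0 < m by apply: leq_ltn_trans (valP i).
  rewrite inE walk_cycle_loop; apply/andP/eqP => [[ml /forallP H]|ml].
    have := dvdn_leq l0 ml; rewrite leq_eqVlt => /orP[/eqP//|lm].
    by have := H (Ordinal lm); rewrite m0 walk_cycle_loop dvdnn.
  split; first by rewrite ml.
  apply/forallP => k; apply/implyP => k0; rewrite walk_cycle_loop.
  by rewrite gtnNdvd ?ml.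
rewrite (eq_card E); case: (m == l); last by rewrite card0.
by rewrite -[RHS]card_ord; apply: eq_card.
Qed.

Lemma on_cycle_cycles s l : 0 < l -> #|on_cycle (cycles s) l| = l * count_mem l s.
Proof.
move=> l0; elim: s => [|m s IHs]; first by rewrite muln0 eq_card0// => -[].
rewrite on_cycle_sum on_cycle_cycle// IHs /= mulnDr; congr (_ + _).
by case: eqP => [->|_]; rewrite ?muln1 ?muln0.
Qed.

(** The multiplicity of l in s is the number of vertices of [cycles s] lying on
    a cycle of length l, divided by l. *)
Lemma cycles_perm s t : all (fun k => 0 < k) s -> all (fun k => 0 < k) t ->
  diso (cycles s) (cycles t) -> perm_eq s t.
Proof.
move=> s0 t0 st; apply: perm_pos => // l l0.
have := diso_on_cycle l st; rewrite !on_cycle_cycles// => /eqP.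
by rewrite eqn_pmul2l// => /eqP.
Qed.

(** * Irreducible and reducible sums of cycles *)

Lemma sum_of_cyclesP (G : digraph) n : sum_of_cycles G -> #|G| = n ->
  exists2 s, s \in int_parts n & diso G (cycles (parts s)).
Proof.
move=> [s s0 Gs] Gn; have sG : is_parts n s.
  by rewrite /is_parts s0 -Gn (diso_card Gs) card_cycles /=.
have [t tP ts] := int_parts_ex sG; exists t => //.
by apply: diso_trans Gs _; apply: perm_cycles; rewrite perm_sym.
Qed.

Lemma int_parts_diso n (s t : n.-bseq 'I_n.+1) :
  s \in int_parts n -> t \in int_parts n ->
  diso (cycles (parts s)) (cycles (parts t)) -> s = t.
Proof.
move=> sP tP st; apply: parts_perm_inj => //; apply: cycles_perm st.
  by case/andP: (parts_is_parts sP).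
by case/andP: (parts_is_parts tP).
Qed.

Lemma irreducible_diso G H : diso G H -> irreducible_sum G -> irreducible_sum H.
Proof.
move=> GH [[s s0 Gs] irrG]; split.
  by exists s => //; apply: diso_trans Gs; apply: diso_sym.
by move=> A B sA sB HAB; apply: irrG => //; apply: diso_trans HAB.
Qed.

Lemma digraph_on_ex (G : digraph) n : #|G| = n ->
  exists E : {set 'I_n * 'I_n}, diso G (digraph_on E).
Proof.
move=> <-; exists [set u | edge (enum_val u.1 : G) (enum_val u.2)]%SET.
exists enum_rank; first by exists enum_val; [exact: enum_rankK|exact: enum_valK].
by move=> x y; rewrite /= inE /= !enum_rankK.
Qed.

Definition irred_parts n : {set n.-bseq 'I_n.+1} :=
  [set s in int_parts n | `[< irreducible_sum (cycles (parts s)) >]]%SET.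

Lemma card_parts_cycles n (s : n.-bseq 'I_n.+1) :
  s \in int_parts n -> #|cycles (parts s)| = n.
Proof. by move/parts_is_parts/andP => [_ /eqP]; rewrite card_cycles. Qed.

(** Relating a partition s to the class of the digraphs isomorphic to
    [cycles s] is injective in both directions, which gives both
    inequalities. *)
Lemma irredE n : irred n = #|irred_parts n|.
Proof.
rewrite /irred; set D := [set E | _]%SET; set R := fun E F => _.
have RP E F : reflect (diso (digraph_on E) (digraph_on F)) (R E F) by apply: asboolP.
pose r (B : {set {set 'I_n * 'I_n}}) (s : n.-bseq 'I_n.+1) :=
  exists2 E, E \in D /\ B = [set F in D | R E F]%SET
    & diso (digraph_on E) (cycles (parts s)).
apply/eqP; rewrite eqn_leq; apply/andP; split.
  apply: (@leq_card_rel _ _ _ _ r).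
    move=> B /imsetP[E ED BE].
    have irrE : irreducible_sum (digraph_on E) by move: ED; rewrite inE => /asboolP.
    have [s sP Es] := sum_of_cyclesP (proj1 irrE) (card_ord n).
    exists s; last by exists E.
    rewrite inE sP; apply/asboolP; exact: irreducible_diso Es irrE.
  move=> B B' s _ _ [E [ED ->] Es] [E' [E'D ->] E's].
  apply/setP => F; rewrite !inE; congr (_ && _).
  have EE' := diso_trans Es (diso_sym E's).
  by apply/RP/RP; apply: diso_trans => //; apply: diso_sym.
apply: (@leq_card_rel _ _ _ _ (fun s B => r B s)).
  move=> s; rewrite inE => /andP[sP /asboolP irrs].
  have [E sE] := digraph_on_ex (card_parts_cycles sP).
  have ED : E \in D by rewrite inE; apply/asboolP/(irreducible_diso sE).
  exists [set F in D | R E F]%SET; first by apply/imsetP; exists E.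
  by exists E => //; apply: diso_sym.
move=> s s' B; rewrite inE => /andP[sP _]; rewrite inE => /andP[s'P _].
move=> [E [ED BE] Es] [E' [E'D BE'] E's'].
apply: int_parts_diso => //; apply: diso_trans (diso_sym Es) _.
apply: diso_trans E's'; apply: diso_sym.
have : E \in B by rewrite BE inE ED; apply/RP/diso_refl.
by rewrite BE' inE => /andP[_ /RP].
Qed.

Definition prod_parts n d e : {set n.-bseq 'I_n.+1} :=
  [set s in int_parts n | `[< exists2 u, u \in setX (int_parts d) (int_parts e) &
     diso (cycles (parts s)) (dprod (cycles (parts u.1)) (cycles (parts u.2))) >]]%SET.

(** The two factors determine the product, hence its partition. *)
Lemma card_prod_parts n d e :
  #|prod_parts n d e| <= partition_number d * partition_number e.
Proof.
rewrite /partition_number -cardsX.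
apply: (@leq_card_rel _ _ _ (setX (int_parts d) (int_parts e)) (fun s u =>
  diso (cycles (parts s)) (dprod (cycles (parts u.1)) (cycles (parts u.2))))).
  by move=> s; rewrite inE => /andP[_ /asboolP[u]]; exists u.
move=> s s' u; rewrite inE => /andP[sP _]; rewrite inE => /andP[s'P _] su s'u.
by apply: int_parts_diso => //; apply: diso_trans su (diso_sym s'u).
Qed.

Lemma sum_of_cycles1 (G : digraph) : sum_of_cycles G -> #|G| = 1 -> diso G (dcycle 1).
Proof.
move=> sG G1; have [s /parts_is_parts sP Gs] := sum_of_cyclesP sG G1.
apply: diso_trans Gs _.
have /perm_cycles/diso_trans : perm_eq (parts s) [:: 1].
  apply: (is_parts_perm sP) => // x x1; rewrite !(count_memPn _)//.
    by rewrite inE; lia.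
  by apply/negP => /(is_parts_le sP); lia.
apply; exact: diso_sum0.
Qed.

(** Neither factor of a reducible sum of cycles on n > 0 vertices can have just
    one vertex, since C_1 is the only sum of cycles with one vertex. *)
Lemma reducible_parts n : 0 < n -> int_parts n \subset irred_parts n :|:
  \bigcup_(d < n.+1 | (1 < d) && (d * (n %/ d) == n) && (1 < n %/ d))
    prod_parts n d (n %/ d).
Proof.
move=> n0; apply/subsetP => s sP; rewrite in_setU inE sP /=.
have [//|red] := boolP `[< irreducible_sum (cycles (parts s)) >].
have socs : sum_of_cycles (cycles (parts s)).
  by exists (parts s); [case/andP: (parts_is_parts sP)|exact: diso_refl].
have [A [B [sA sB sAB A1 B1]]] : exists A B, [/\ sum_of_cycles A, sum_of_cycles B,
    diso (cycles (parts s)) (dprod A B), ~ diso A (dcycle 1) & ~ diso B (dcycle 1)].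
  apply: contrapT => H; move/negP: red; apply; apply/asboolP; split=> // A B sA sB sAB.
  apply: contrapT => /not_orP[A1 B1]; apply: H; exists A, B; by split.
have nAB : n = #|A| * #|B|.
  by rewrite -card_prod -(diso_card sAB) card_parts_cycles.
have {}A1 : 1 < #|A|.
  have : #|A| != 1 by apply/eqP => /(sum_of_cycles1 sA).
  by move: n0; rewrite nAB; lia.
have {}B1 : 1 < #|B|.
  have : #|B| != 1 by apply/eqP => /(sum_of_cycles1 sB).
  by move: n0; rewrite nAB; lia.
have BE : n %/ #|A| = #|B| by rewrite nAB mulKn// ltnW.
have An : #|A| < n.+1 by rewrite ltnS nAB leq_pmulr// ltnW.
apply/bigcupP; exists (Ordinal An); rewrite /= ?A1 ?BE ?B1 -?nAB ?eqxx//.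
rewrite inE sP; apply/asboolP.
have [a aP Aa] := sum_of_cyclesP sA erefl.
have [b bP Bb] := sum_of_cyclesP sB erefl.
exists (a, b); first by rewrite inE aP.
by apply: diso_trans sAB _; apply: diso_prod.
Qed.

Lemma irred_le n : irred n <= partition_number n.
Proof.
by rewrite irredE; apply/subset_leq_card/subsetP => s; rewrite inE => /andP[].
Qed.

(** There are at most n factorisations n = d e with d, e > 1, and each
    contributes at most p(9) p(n / 2) reducible sums. *)
Lemma partition_number_le_irred n : 0 < n ->
  partition_number n
  <= irred n + n * (partition_number 9 * partition_number (n %/ 2)).
Proof.
move=> n0; rewrite irredE.
apply: leq_trans (subset_leq_card (reducible_parts n0)) _.
apply: leq_trans (leq_card_setU _ _) _; rewrite leq_add2l.
pose P (d : 'I_n.+1) := (1 < d) && (d * (n %/ d) == n) && (1 < n %/ d).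
have F (d : 'I_n.+1) : P d -> #|prod_parts n d (n %/ d)| <=
    partition_number 9 * partition_number (n %/ 2).
  case/andP=> /andP[d1 /eqP dn] nd1; apply: leq_trans (card_prod_parts _ _ _) _.
  exact: partition_number_factor.
apply: leq_trans (@card_bigcup_le _ _ P _ _ F) _; rewrite leq_mul2r; apply/orP; right.
rewrite -ltnS -[X in _ < X]card_ord; apply/proper_card/properP.
by split; [exact/subsetP|exists ord0].
Qed.

(** * The limit *)

Local Open Scope classical_set_scope.
Local Open Scope ring_scope.

Theorem proposition1 (R : realType) :
  (fun n : nat => (irred n)%:R / (partition_number n)%:R : R) @ \oo --> (1 : R).
Proof.
pose C : R := (16 * partition_number 9)%:R.
(* n c p(n / 2) <= 8 c p(n) / n <= 16 c p(n) / (n + 1), where c = p(9). *)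
apply: (@squeeze_cvgr nat \oo _ R (fun n => 1 - C * harmonic n) (fun=> 1)).
- exists (2 ^ 14)%N => //= n n14.
  have n0 : (0 < n)%N by apply: leq_trans n14.
  have p0 : (0 : R) < (partition_number n)%:R.
    by rewrite ltr0n partition_number_gt0.
  rewrite ler_pdivlMr// ler_pdivrMr// mul1r ler_nat irred_le andbT.
  have red : (n.+1 * partition_number n
      <= n.+1 * irred n + 16 * partition_number 9 * partition_number n)%N.
    have := partition_number_le_irred n0; have := partition_number_half n14.
    set q := partition_number (n %/ 2).
    set p := partition_number n; set c := partition_number 9.
    move=> half pI.
    apply: (@leq_trans (n.+1 * (irred n + n * (c * q)))); first by rewrite leq_mul2l pI.
    rewrite mulnDr leq_add2l.
    apply: (@leq_trans (2 * c * (n ^ 2 * q))); first by nia.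
    by nia.
  rewrite -(ler_pM2l (_ : 0 < n.+1%:R)) ?ltr0n// mulrA mulrBr mulr1.
  rewrite /harmonic /= mulrCA mulfV ?pnatr_eq0// mulr1 mulrBl lerBlDr.
  by rewrite -!natrM -natrD ler_nat.
- rewrite -[X in _ --> X]subr0; apply: cvgB; first exact: cvg_cst.
  by rewrite -[X in _ --> X](mulr0 C); apply: cvgMr; exact: cvg_harmonic.
- exact: cvg_cst.
Qed.
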